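(* For any group $G$, the families (i) $\{\mathrm{Aut}(G^n),\ n\ge0\}$, (ii) $\{\mathrm{Hol}(G^n),\ n\ge0\}$, and (iii) $\{\mathrm{Aut}(\ast_nG),\ n\ge0\}$ form permutative categories (the first two being denoted $\mathcal{A}ut(G^n)$ and $\mathcal{H}ol(G^n)$), with the following structure. Objects are the nonnegative integers. There are no morphisms from $m$ to $n$ if $m\ne n$, and $\mathrm{Hom}(n,n)$ is $\mathrm{Aut}(G^n)$ in (i), $\mathrm{Hol}(G^n)$ in (ii), $\mathrm{Aut}(\ast_nG)$ in (iii). The bifunctor $\square$ is defined on objects by $m\,\square\,n=m+n$ and on morphisms by (i) $f_m\,\square\,g_n=f_m\times g_n$, (ii) $(f_m,(x_1,\ldots,x_m))\,\square\,(g_n,(y_1,\ldots,y_n))=(f_m\times g_n,(x_1,\ldots,x_m,y_1,\ldots,y_n))$, (iii) $f_m\,\square\,g_n=f_m\times g_n$, where in (i) and (ii) $f_m\in\mathrm{Aut}(G^m)$, $g_n\in\mathrm{Aut}(G^n)$ and $f_m\times g_n\in\mathrm{Aut}(G^{m+n})$ is their product, and in (iii) $f_m\in\mathrm{Aut}(\ast_mG)$, $g_n\in\mathrm{Aut}(\ast_nG)$ and $f_m\times g_n\in\mathrm{Aut}(\ast_{m+n}G)$ is their product (acting as $f_m$ on the first $m$ free factors and as $g_n$ on the last $n$). The unit object is $0$, and the commutativity isomorphism $c$ is given by (i) $c(m,n)=s_{m,n}$, (ii) $c(m,n)=(s_{m,n},1_{G^{m+n}})$, (iii) $c(m,n)(x_i)=x_{i+n}$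 if $1\le i\le m$, and $c(m,n)(x_i)=x_{i-m}$ if $m+1\le i\le m+n$, where $s_{m,n}\in\mathrm{Aut}(G^{m+n})$ is defined by $s_{m,n}(x_1,\ldots,x_m,x_{m+1},\ldots,x_{m+n})=(x_{m+1},\ldots,x_{m+n},x_1,\ldots,x_m)$ and $1_{G^{m+n}}$ is the identity element of $G^{m+n}$. Moreover, there are permutative functors between $\mathcal{A}ut(G^n)$ and $\mathcal{H}ol(G^n)$ (in both directions) given by the identity maps on objects and the natural maps between $\mathrm{Aut}(G^m)$ and $\mathrm{Hol}(G^m)$ on morphisms.
   Context: For a group $K$, $\mathrm{Hol}(K)$ is the group of pairs $(f,x)$, $f\in\mathrm{Aut}(K)$, $x\in K$, with multiplication $(f,x)(g,y)=(fg,g^{-1}(x)y)$; the natural maps are $\mathrm{Hol}(K)\to\mathrm{Aut}(K)$, $(f,x)\mapsto f$, and its section $\mathrm{Aut}(K)\to\mathrm{Hol}(K)$, $f\mapsto(f,1)$. $G^n$ is the direct product and $\ast_nG$ the free product of $n$ copies of $G$ (trivial for $n=0$). In (iii), for $x\in G$, $x_i$ denotes the copy of $x$ in the $i$-th free factor. A permutative category $(\mathfrak{C},\square,0,c)$ is a small category $\mathfrak{C}$ with a bifunctor $\square:\mathfrak{C}\times\mathfrak{C}\to\mathfrak{C}$, an object $0$, and a natural isomorphism $c$ from $\square$ to $\square\tau$ ($\tau$ the interchange of factors), i.e. isomorphisms $c(\alpha,\beta):\alpha\square\beta\to\beta\square\alpha$ such that for all $A:\alpha\to\gamma$, $B:\beta\to\delta$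 one has $c(\gamma,\delta)\circ(A\square B)=(B\square A)\circ c(\alpha,\beta)$, satisfying: (1) $\square$ is (strictly) associative; (2) $0$ is a (strict) left and right unit for $\square$; (3) $c(\alpha,0)=1_\alpha=c(0,\alpha)$; (4) $c(\beta,\alpha)=c(\alpha,\beta)^{-1}$; (5) $(c(\gamma,\alpha)\square1_\beta)\circ c(\alpha\square\beta,\gamma)=1_\alpha\square c(\beta,\gamma)$ for all objects $\alpha,\beta,\gamma$. A permutative functor is a functor that commutes with $\square$ and $c$ and sends $0$ to $0$. *)

(* Defs.v *)
From HB Require Import structures.
From mathcomp Require Import all_boot.
From mathcomp Require Import boolp.

Set Implicit Arguments.
Unset Strict Implicit.
Unset Printing Implicit Defensive.

Local Open Scope group_scope.
Local Open Scope quotient_scope.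

(* [box], [boxm] are the object and morphism parts of the bifunctor,
   [unit_ob] is the unit object, [braid] the commutativity isomorphism;
   [compm g f] is the composite of [f] followed by [g]. *)
Record permcat_data := PermcatData {
  ob :> Type;
  hom : ob -> ob -> Type;
  idm : forall a, hom a a;
  compm : forall a b c, hom b c -> hom a b -> hom a c;
  box : ob -> ob -> ob;
  boxm : forall a a' b b', hom a a' -> hom b b' -> hom (box a b) (box a' b');
  unit_ob : ob;
  braid : forall a b, hom (box a b) (box b a)
}.

Arguments hom {p} a b.
Arguments idm {p} a.
Arguments compm {p a b c} g f.
Arguments box {p} a b.
Arguments boxm {p a a' b b'} f g.
Arguments unit_ob {p}.
Arguments braid {p} a b.

(* The set of all morphisms of C. Two morphisms whose (co)domains are equal but
   not syntactically so are compared here: [arr f = arr g] says that f and g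
   have the same domain and codomain and are the same morphism. *)
Definition arrow (C : permcat_data) := {ab : C * C & hom ab.1 ab.2}.

Definition arr (C : permcat_data) (a b : C) (f : hom a b) : arrow C :=
  existT (fun ab : C * C => hom ab.1 ab.2) (a, b) f.

Definition hom_castr (C : permcat_data) (a b b' : C) (e : b = b')
    (f : hom a b) : hom a b' :=
  eq_rect b (fun x => hom a x) f b' e.

Definition inverse_hom (C : permcat_data) (a b : C) (f : hom a b) (g : hom b a) :=
  compm g f = idm a /\ compm f g = idm b.

(* In the last axiom, [braid (box a b) c] ends at [box c (box a b)] and
   [boxm (braid c a) (idm b)] starts at [box (box c a) b]. *)
Record is_permutative (C : permcat_data) : Prop := IsPermutative {
  comp1m : forall (a b : C) (f : hom a b), compm (idm b) f = f;
  compm1 : forall (a b : C) (f : hom a b), compm f (idm a) = f;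
  compA : forall (a b c d : C) (h : hom c d) (g : hom b c) (f : hom a b),
    compm h (compm g f) = compm (compm h g) f;
  boxm1 : forall a b : C, boxm (idm a) (idm b) = idm (box a b);
  boxm_comp : forall (a a' a'' b b' b'' : C)
      (f' : hom a' a'') (f : hom a a') (g' : hom b' b'') (g : hom b b'),
    boxm (compm f' f) (compm g' g) = compm (boxm f' g') (boxm f g);
  braid_nat : forall (a b c d : C) (f : hom a c) (g : hom b d),
    compm (braid c d) (boxm f g) = compm (boxm g f) (braid a b);
  braid_iso : forall a b : C, exists g, inverse_hom (braid a b) g;
  boxA : forall a b c : C, box a (box b c) = box (box a b) c;
  boxmA : forall (a a' b b' c c' : C)
      (f : hom a a') (g : hom b b') (h : hom c c'),
    arr (boxm f (boxm g h)) = arr (boxm (boxm f g) h);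
  box0 : forall a : C, box a unit_ob = a;
  box0l : forall a : C, box unit_ob a = a;
  boxm0 : forall (a b : C) (f : hom a b), arr (boxm f (idm unit_ob)) = arr f;
  boxm0l : forall (a b : C) (f : hom a b), arr (boxm (idm unit_ob) f) = arr f;
  braid0 : forall a : C, arr (braid a unit_ob) = arr (idm a);
  braid0l : forall a : C, arr (braid unit_ob a) = arr (idm a);
  braid_inv : forall a b : C, inverse_hom (braid a b) (braid b a);
  braid_hexagon : forall a b c : C,
    arr (compm (boxm (braid c a) (idm b))
              (hom_castr (boxA c a b) (braid (box a b) c)))
    = arr (boxm (idm a) (braid b c))
}.

Record functor_data (C D : permcat_data) := FunctorData {
  fob :> C -> D;
  fmor : forall a b : C, hom a b -> hom (fob a) (fob b)
}.

Arguments fmor {C D} f {a b} u.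

Record is_permutative_functor (C D : permcat_data) (F : functor_data C D) :
    Prop := IsPermutativeFunctor {
  fmor1 : forall a : C, fmor F (idm a) = idm (F a);
  fmor_comp : forall (a b c : C) (g : hom b c) (f : hom a b),
    fmor F (compm g f) = compm (fmor F g) (fmor F f);
  fob_box : forall a b : C, F (box a b) = box (F a) (F b);
  fmor_box : forall (a a' b b' : C) (f : hom a a') (g : hom b b'),
    arr (fmor F (boxm f g)) = arr (boxm (fmor F f) (fmor F g));
  fob_unit : F unit_ob = unit_ob;
  fmor_braid : forall a b : C, arr (fmor F (braid a b)) = arr (braid (F a) (F b))
}.

Section GroupSequence.
Variable A : nat -> groupType.

(* Hom(n, n) = A n and no morphisms from m to n if m <> n: the condition
   [m == n] does not depend on f. A morphism from m to n is stored as an element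
   of the group of its domain, so that the commutativity isomorphism
   m + n -> n + m is an element of A (m + n); only composition needs a cast. *)
Definition ghom (m n : nat) := {f : A m | m == n}.

Definition gcast (m n : nat) (e : m = n) (x : A n) : A m :=
  eq_rect n A x m (esym e).

Definition gid (n : nat) : ghom n n := exist _ 1 (eqxx n).

Definition gcomp (m n p : nat) (g : ghom n p) (f : ghom m n) : ghom m p :=
  exist _ (gcast (eqP (valP f)) (val g) * val f)
    (eq_trans (congr1 (eq_op^~ p) (eqP (valP f))) (valP g)).

Variable bx : forall m n, A m -> A n -> A (m + n)%N.
Variable c : forall m n, A (m + n)%N.

Lemma gbox_subproof (m m' n n' : nat) (f : ghom m m') (g : ghom n n') :
  (m + n == m' + n')%N.
Proof. by rewrite (eqP (valP f)) (eqP (valP g)). Qed.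

Definition gbox (m m' n n' : nat) (f : ghom m m') (g : ghom n n') :
    ghom (m + n) (m' + n') :=
  exist _ (bx (val f) (val g)) (gbox_subproof f g).

Definition gbraid (m n : nat) : ghom (m + n) (n + m) :=
  exist _ (c m n) (introT eqP (addnC m n)).

Definition group_permcat : permcat_data :=
  @PermcatData nat ghom gid gcomp addn gbox 0%N gbraid.

End GroupSequence.

Definition group_functor (A B : nat -> groupType)
    (bA : forall m n, A m -> A n -> A (m + n)%N) (cA : forall m n, A (m + n)%N)
    (bB : forall m n, B m -> B n -> B (m + n)%N) (cB : forall m n, B (m + n)%N)
    (phi : forall n, A n -> B n) :
    functor_data (group_permcat bA cA) (group_permcat bB cB) :=
  @FunctorData (group_permcat bA cA) (group_permcat bB cB) id
    (fun m n (f : ghom A m n) => exist _ (phi m (val f)) (valP f) : ghom B m n).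

Record aut (K : groupType) := Aut {
  aut_fun :> {multiplicative K -> K};
  aut_bij : bijective aut_fun
}.

Lemma multP (G H : groupType) (f g : {multiplicative G -> H}) :
  f =1 g -> f = g.
Proof.
case: f g => [f [[fM]]] [g [[gM]]] /= /funext fg; case: _ / fg in gM *.
by rewrite (Prop_irrelevance fM gM).
Qed.

Section AutGroup.
Variable K : groupType.
Implicit Types f g h : aut K.

Lemma autP f g : f =1 g -> f = g.
Proof.
case: f g => [f fb] [g gb] /= /multP fg; case: _ / fg in gb *.
by rewrite (Prop_irrelevance fb gb).
Qed.

HB.instance Definition _ := gen_eqMixin (aut K).
HB.instance Definition _ := gen_choiceMixin (aut K).

Lemma aut_inv_ex f : exists g : K -> K, cancel f g /\ cancel g f.
Proof. by case: (aut_bij f) => g fg gf; exists g. Qed.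

Definition aut_inv_fun f : K -> K := projT1 (cid (aut_inv_ex f)).

Lemma aut_funK f : cancel f (aut_inv_fun f).
Proof. by rewrite /aut_inv_fun; case: cid => g []. Qed.

Lemma aut_inv_funK f : cancel (aut_inv_fun f) f.
Proof. by rewrite /aut_inv_fun; case: cid => g []. Qed.

HB.instance Definition _ f := isMultiplicative.Build K K (aut_inv_fun f)
  (can2_gmulfM (aut_funK f) (aut_inv_funK f)).

(* Products of automorphisms are composites: (f * g) x = f (g x). *)
Definition aut_one : aut K := @Aut K idfun (Bijective (frefl _) (frefl _)).

Definition aut_mul f g : aut K :=
  @Aut K (f \o g) (bij_comp (aut_bij f) (aut_bij g)).

Definition aut_inv f : aut K :=
  @Aut K (aut_inv_fun f) (Bijective (aut_inv_funK f) (aut_funK f)).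

Fact aut_mulA : associative aut_mul. Proof. by move=> f g h; apply: autP. Qed.
Fact aut_mul1l : left_id aut_one aut_mul. Proof. by move=> f; apply: autP. Qed.
Fact aut_mulr1 : right_id aut_one aut_mul. Proof. by move=> f; apply: autP. Qed.
Fact aut_mulV : left_inverse aut_one aut_inv aut_mul.
Proof. by move=> f; apply: autP => x /=; rewrite aut_funK. Qed.
Fact aut_Vmul : right_inverse aut_one aut_inv aut_mul.
Proof. by move=> f; apply: autP => x /=; rewrite aut_inv_funK. Qed.

HB.instance Definition _ :=
  isGroup.Build (aut K) aut_mulA aut_mul1l aut_mulr1 aut_mulV aut_Vmul.

Lemma aut_mulE f g x : (f * g) x = f (g x). Proof. by []. Qed.
Lemma aut_oneE x : (1 : aut K) x = x. Proof. by []. Qed.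
Lemma aut_VK f x : f^-1 (f x) = x. Proof. by rewrite -aut_mulE mulVg. Qed.
Lemma aut_KV f x : f (f^-1 x) = x. Proof. by rewrite -aut_mulE mulgV. Qed.
Lemma aut1g f : f 1 = 1.
Proof. by apply: (@mulgI K (f 1)); rewrite -gmulfM !mulg1. Qed.

End AutGroup.

Record hol (K : groupType) := Hol { hol_aut : aut K; hol_elt : K }.

Section HolGroup.
Variable K : groupType.
Implicit Types u v w : hol K.

HB.instance Definition _ := gen_eqMixin (hol K).
HB.instance Definition _ := gen_choiceMixin (hol K).

(* (f, x) (g, y) = (f g, g^-1(x) y) *)
Definition hol_one : hol K := Hol 1 1.

Definition hol_mul u v : hol K :=
  Hol (hol_aut u * hol_aut v) ((hol_aut v)^-1 (hol_elt u) * hol_elt v).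

Definition hol_inv u : hol K := Hol (hol_aut u)^-1 (hol_aut u (hol_elt u)^-1).

Fact hol_mulA : associative hol_mul.
Proof.
move=> [f x] [g y] [h z]; congr Hol; first exact: mulgA.
by rewrite [hol_aut _]/(g * h) invgM
  [hol_elt (hol_mul _ _)]/(h^-1 y * z) mulgA gmulfM.
Qed.
Fact hol_mul1l : left_id hol_one hol_mul.
Proof.
move=> [f x]; congr Hol; first exact: mul1g.
by rewrite [hol_elt _]/(1 : K) aut1g mul1g.
Qed.
Fact hol_mulr1 : right_id hol_one hol_mul.
Proof.
move=> [f x]; congr Hol; first exact: mulg1.
by rewrite [hol_aut _]/(1 : aut K) invg1 [LHS]mulg1.
Qed.
Fact hol_mulV : left_inverse hol_one hol_inv hol_mul.
Proof.
move=> [f x]; congr Hol; first exact: mulVg.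
by rewrite [hol_elt (hol_inv _)]/(f x^-1) aut_VK mulVg.
Qed.
Fact hol_Vmul : right_inverse hol_one hol_inv hol_mul.
Proof.
move=> [f x]; congr Hol; first exact: mulgV.
by rewrite [hol_aut (hol_inv _)]/(f^-1) invgK -gmulfM mulgV aut1g.
Qed.

HB.instance Definition _ :=
  isGroup.Build (hol K) hol_mulA hol_mul1l hol_mulr1 hol_mulV hol_Vmul.

Definition hol_sect (f : aut K) : hol K := Hol f 1.

End HolGroup.

Definition pow (G : groupType) (n : nat) : groupType := {ffun 'I_n -> G}.

Section DirectPower.
Variable G : groupType.

Section Blocks.
Variables m n : nat.

Definition pow_cat (x : pow G m) (y : pow G n) : pow G (m + n) :=
  [ffun i => match split i with inl j => x j | inr k => y k end].

Definition pow_l (x : pow G (m + n)) : pow G m := [ffun j => x (lshift n j)].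
Definition pow_r (x : pow G (m + n)) : pow G n := [ffun k => x (rshift m k)].

Lemma pow_catE x : pow_cat (pow_l x) (pow_r x) = x.
Proof.
by apply/ffunP => i; rewrite ffunE; case: split_ordP => j ->; rewrite ffunE.
Qed.

Lemma pow_catl x y : pow_l (pow_cat x y) = x.
Proof. by apply/ffunP => i; rewrite !ffunE (unsplitK (inl _ i)). Qed.

Lemma pow_catr x y : pow_r (pow_cat x y) = y.
Proof. by apply/ffunP => i; rewrite !ffunE (unsplitK (inr _ i)). Qed.

Lemma pow_catM x x' y y' :
  pow_cat (x * x') (y * y') = pow_cat x y * pow_cat x' y'.
Proof. by apply/ffunP => i; rewrite !ffunE; case: split => j; rewrite ffunE. Qed.

Lemma pow_lM : {morph pow_l : x y / x * y}.
Proof. by move=> x y; apply/ffunP => i; rewrite !ffunE. Qed.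

Lemma pow_rM : {morph pow_r : x y / x * y}.
Proof. by move=> x y; apply/ffunP => i; rewrite !ffunE. Qed.

Definition prod_fun (f : pow G m -> pow G m) (g : pow G n -> pow G n)
  (x : pow G (m + n)) : pow G (m + n) := pow_cat (f (pow_l x)) (g (pow_r x)).

Lemma prod_fun_can f f' g g' :
  cancel f f' -> cancel g g' -> cancel (prod_fun f g) (prod_fun f' g').
Proof.
by move=> fK gK x; rewrite /prod_fun pow_catl pow_catr fK gK pow_catE.
Qed.

Lemma prod_funM (f : aut (pow G m)) (g : aut (pow G n)) :
  {morph prod_fun f g : x y / x * y}.
Proof. by move=> x y; rewrite /prod_fun pow_lM pow_rM !gmulfM pow_catM. Qed.

HB.instance Definition _ (f : aut (pow G m)) (g : aut (pow G n)) :=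
  isMultiplicative.Build (pow G (m + n)) (pow G (m + n)) (prod_fun f g)
    (prod_funM f g).

Lemma prod_fun_bij (f : aut (pow G m)) (g : aut (pow G n)) :
  bijective (prod_fun f g).
Proof.
case: (aut_bij f) (aut_bij g) => [f' fK f'K] [g' gK g'K].
by exists (prod_fun f' g'); apply: prod_fun_can.
Qed.

Definition aut_prod (f : aut (pow G m)) (g : aut (pow G n)) :
    aut (pow G (m + n)) :=
  @Aut (pow G (m + n)) (prod_fun f g) (prod_fun_bij f g).

End Blocks.

(* (x_1, ..., x_(m+n)) |-> (x_(m+1), ..., x_(m+n), x_1, ..., x_m), read as an
   endomap of G^(m+n) although the right-hand side is naturally in G^(n+m). *)
Definition swap_fun (m n : nat) (x : pow G (m + n)) : pow G (m + n) :=
  [ffun i => pow_cat (pow_r x) (pow_l x) (cast_ord (addnC m n) i)].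

Lemma swap_funM (m n : nat) : {morph @swap_fun m n : x y / x * y}.
Proof.
by move=> x y; apply/ffunP => i; rewrite [LHS]ffunE pow_lM pow_rM pow_catM !ffunE.
Qed.

HB.instance Definition _ (m n : nat) :=
  isMultiplicative.Build (pow G (m + n)) (pow G (m + n)) (@swap_fun m n)
    (@swap_funM m n).

Lemma swap_fun_bij (m n : nat) : bijective (@swap_fun m n).
Proof.
pose r (x : pow G (m + n)) : pow G (n + m) :=
  [ffun i => x (cast_ord (esym (addnC m n)) i)].
have rK x : r (swap_fun x) = pow_cat (pow_r x) (pow_l x).
  by apply/ffunP => i; rewrite /r ffunE /swap_fun ffunE cast_ordKV.
exists (fun x => pow_cat (pow_r (r x)) (pow_l (r x))) => x.
  by rewrite rK pow_catl pow_catr pow_catE.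
apply/ffunP => i; rewrite /swap_fun ffunE pow_catl pow_catr pow_catE /r ffunE.
by rewrite cast_ordK.
Qed.

Definition aut_swap (m n : nat) : aut (pow G (m + n)) :=
  @Aut (pow G (m + n)) (@swap_fun m n) (@swap_fun_bij m n).

Definition hol_prod (m n : nat) (u : hol (pow G m)) (v : hol (pow G n)) :
    hol (pow G (m + n)) :=
  Hol (aut_prod (hol_aut u) (hol_aut v)) (pow_cat (hol_elt u) (hol_elt v)).

Definition hol_swap (m n : nat) : hol (pow G (m + n)) := Hol (aut_swap m n) 1.

End DirectPower.

Section FreeProduct.
Variables (I : finType) (G : groupType).

(* The letter (i, x) is the copy of x in the i-th free factor. *)
Definition word := seq (I * G).

(* The congruence on words generated by (i, x)(i, y) ~ (i, x y) and (i, 1) ~ 1;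
   the free product is the quotient of the monoid of words by it. *)
Inductive word_eq : word -> word -> Prop :=
| word_eq_refl u : word_eq u u
| word_eq_sym u v : word_eq u v -> word_eq v u
| word_eq_trans u v w : word_eq u v -> word_eq v w -> word_eq u w
| word_eq_mul u v i x y :
    word_eq (u ++ [:: (i, x); (i, y)] ++ v) (u ++ [:: (i, x * y)] ++ v)
| word_eq_one u v i : word_eq (u ++ [:: (i, 1)] ++ v) (u ++ v).

Definition word_eqb : rel word := fun u v => `[< word_eq u v >].

Fact word_eqb_refl : reflexive word_eqb.
Proof. by move=> u; apply/asboolP/word_eq_refl. Qed.
Fact word_eqb_sym : symmetric word_eqb.
Proof. by move=> u v; apply/asboolP/asboolP; apply: word_eq_sym. Qed.
Fact word_eqb_trans : transitive word_eqb.
Proof.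
move=> v u w /asboolP uv /asboolP vw; apply/asboolP.
exact: word_eq_trans uv vw.
Qed.

Canonical word_equiv := EquivRel word_eqb word_eqb_refl word_eqb_sym
  word_eqb_trans.

Definition freeprod := {eq_quot word_equiv}.
HB.instance Definition _ := Choice.on freeprod.
HB.instance Definition _ := EqQuotient.on freeprod.

Implicit Types a b c : freeprod.

Lemma freeprodP (u v : word) : word_eq u v <-> \pi_freeprod u = \pi_freeprod v.
Proof. by split=> [uv|/eqmodP/asboolP//]; apply/eqmodP/asboolP. Qed.

Lemma word_eq_repr (u : word) : word_eq (repr (\pi_freeprod u)) u.
Proof. by apply/freeprodP; rewrite reprK. Qed.

Lemma word_eq_catl (w u v : word) : word_eq u v -> word_eq (w ++ u) (w ++ v).
Proof.
elim=> {u v} [u|u v _|u v t _ uv _|u v i x y|u v i].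
- exact: word_eq_refl.
- exact: word_eq_sym.
- exact: word_eq_trans uv.
- by rewrite !(catA w u); apply: word_eq_mul.
- by rewrite !(catA w u); apply: word_eq_one.
Qed.

Lemma word_eq_catr (w u v : word) : word_eq u v -> word_eq (u ++ w) (v ++ w).
Proof.
elim=> {u v} [u|u v _|u v t _ uv _|u v i x y|u v i].
- exact: word_eq_refl.
- exact: word_eq_sym.
- exact: word_eq_trans uv.
- by rewrite -!catA; apply: word_eq_mul.
- by rewrite -!catA; apply: word_eq_one.
Qed.

Definition word_inv (u : word) : word := rev [seq (p.1, p.2^-1) | p <- u].

Definition fp_one : freeprod := \pi_freeprod [::].
Definition fp_mul a b : freeprod := \pi_freeprod (repr a ++ repr b).
Definition fp_inv a : freeprod := \pi_freeprod (word_inv (repr a)).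

Lemma fp_mul_pi (u v : word) :
  fp_mul (\pi_freeprod u) (\pi_freeprod v) = \pi_freeprod (u ++ v).
Proof.
apply/freeprodP; apply: (word_eq_trans (v := u ++ repr (\pi_freeprod v))).
  exact/word_eq_catr/word_eq_repr.
exact/word_eq_catl/word_eq_repr.
Qed.

Lemma word_mulV (u : word) : word_eq (u ++ word_inv u) [::].
Proof.
elim: u => [|[i x] u IHu]; first exact: word_eq_refl.
rewrite /word_inv /= rev_cons -/(word_inv u) -rcons_cat -cats1 -cat_cons.
apply: (word_eq_trans (v := [:: (i, x)] ++ [:: (i, x^-1)])).
  by rewrite -cat1s; apply: word_eq_catr; apply: (word_eq_catl [:: _] IHu).
apply: word_eq_trans (word_eq_mul [::] [::] i x x^-1) _.
by rewrite mulgV; apply: (word_eq_one [::] [::]).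
Qed.

Lemma word_invK : involutive word_inv.
Proof.
move=> u; rewrite /word_inv map_rev revK -map_comp -[RHS]map_id.
by apply: eq_map => -[i x] /=; rewrite invgK.
Qed.

Lemma word_mulVr (u : word) : word_eq (word_inv u ++ u) [::].
Proof. by rewrite -{2}[u]word_invK; apply: word_mulV. Qed.

Fact fp_mulA : associative fp_mul.
Proof.
move=> a b c; rewrite -[a]reprK -[b]reprK -[c]reprK.
move: (repr a) (repr b) (repr c) => u v w.
by rewrite (fp_mul_pi v w) (fp_mul_pi u v) 2!fp_mul_pi catA.
Qed.
Fact fp_mul1l : left_id fp_one fp_mul.
Proof. by move=> a; rewrite -[a]reprK fp_mul_pi. Qed.
Fact fp_mulr1 : right_id fp_one fp_mul.
Proof. by move=> a; rewrite -[a]reprK fp_mul_pi cats0. Qed.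
Fact fp_mulV : left_inverse fp_one fp_inv fp_mul.
Proof.
move=> a; rewrite -{2}[a]reprK fp_mul_pi.
exact/freeprodP/word_mulVr.
Qed.
Fact fp_Vmul : right_inverse fp_one fp_inv fp_mul.
Proof.
move=> a; rewrite -{1}[a]reprK fp_mul_pi.
exact/freeprodP/word_mulV.
Qed.

HB.instance Definition _ :=
  isGroup.Build freeprod fp_mulA fp_mul1l fp_mulr1 fp_mulV fp_Vmul.

Definition fp_in_fun (i : I) (x : G) : freeprod := \pi_freeprod [:: (i, x)].

Lemma fp_in_funM (i : I) : {morph fp_in_fun i : x y / x * y}.
Proof.
move=> x y; rewrite [RHS]fp_mul_pi; apply/freeprodP/word_eq_sym.
exact: (word_eq_mul [::] [::]).
Qed.

HB.instance Definition _ (i : I) :=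
  isMultiplicative.Build G freeprod (fp_in_fun i) (fp_in_funM i).

Definition fp_in (i : I) : {multiplicative G -> freeprod} := fp_in_fun i.

Lemma fp_prodE (u : word) : \pi_freeprod u = \prod_(p <- u) fp_in p.1 p.2.
Proof.
elim: u => [|[i x] u IHu]; first by rewrite big_nil.
by rewrite big_cons -IHu [RHS]fp_mul_pi.
Qed.

End FreeProduct.

Lemma mult1 (G H : groupType) (f : {multiplicative G -> H}) : f 1 = 1.
Proof. by apply: (@mulgI H (f 1)); rewrite -gmulfM !mulg1. Qed.

Section UniversalProperty.
Variables (I : finType) (G H : groupType) (h : I -> {multiplicative G -> H}).

Definition word_val (u : word I G) : H := \prod_(p <- u) h p.1 p.2.

Definition fp_lift_fun (a : freeprod I G) : H := word_val (repr a).

Lemma word_val_eq (u v : word I G) : word_eq u v -> word_val u = word_val v.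
Proof.
elim=> {u v} [u|u v _|u v t _ -> _|u v i x y|u v i] //.
  by rewrite /word_val !big_cat /= !big_cons big_nil /= gmulfM !mulg1.
by rewrite /word_val !big_cat /= !big_cons big_nil /= mult1 !mul1g.
Qed.

Lemma fp_lift_pi (u : word I G) :
  fp_lift_fun (\pi_(freeprod I G) u) = word_val u.
Proof. exact/word_val_eq/word_eq_repr. Qed.

Lemma fp_lift_funM : {morph fp_lift_fun : a b / a * b}.
Proof.
by move=> a b; rewrite [a * b]/(fp_mul a b) fp_lift_pi /word_val big_cat.
Qed.

HB.instance Definition _ :=
  isMultiplicative.Build (freeprod I G) H fp_lift_fun fp_lift_funM.

(* The homomorphism out of the free product whose restriction to the i-th
   factor is h i. *)
Definition fp_lift : {multiplicative freeprod I G -> H} := fp_lift_fun.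

Lemma fp_lift_in (i : I) (x : G) : fp_lift (fp_in G i x) = h i x.
Proof. by rewrite [LHS]fp_lift_pi /word_val big_cons big_nil mulg1. Qed.

Lemma freeprod_ext (f g : {multiplicative freeprod I G -> H}) :
  (forall i x, f (fp_in G i x) = g (fp_in G i x)) -> f =1 g.
Proof.
move=> fg a; rewrite -[a]reprK fp_prodE; move: (repr a) => u.
elim: u => [|p u IHu]; first by rewrite big_nil !mult1.
by rewrite big_cons !gmulfM IHu fg.
Qed.

End UniversalProperty.

Definition fpow (G : groupType) (n : nat) : groupType := freeprod 'I_n G.

Section FreePower.
Variable G : groupType.

Definition fp_reindex (I J : finType) (s : I -> J) :
    {multiplicative freeprod I G -> freeprod J G} :=
  fp_lift (fun i => fp_in G (s i)).

Section Blocks.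
Variables m n : nat.

(* x_i |-> f x_i if i is among the first m indices, and otherwise, i being the
   k-th of the last n indices, x_i |-> g x_k shifted into the last n factors. *)
Definition fp_prod_fun (f : {multiplicative fpow G m -> fpow G m})
    (g : {multiplicative fpow G n -> fpow G n}) :
    {multiplicative fpow G (m + n) -> fpow G (m + n)} :=
  fp_lift (fun i => match split i with
    | inl j => fp_reindex (@lshift m n) \o (f \o fp_in G j)
    | inr k => fp_reindex (@rshift m n) \o (g \o fp_in G k)
    end : {multiplicative G -> fpow G (m + n)}).

Lemma fp_prod_funl f g (a : fpow G m) :
  fp_prod_fun f g (fp_reindex (@lshift m n) a) = fp_reindex (@lshift m n) (f a).
Proof.
apply: (freeprod_ext (f := fp_prod_fun f g \o fp_reindex (@lshift m n))
  (g := fp_reindex (@lshift m n) \o f)) => i x /=.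
by rewrite !fp_lift_in (unsplitK (inl _ i)).
Qed.

Lemma fp_prod_funr f g (a : fpow G n) :
  fp_prod_fun f g (fp_reindex (@rshift m n) a) = fp_reindex (@rshift m n) (g a).
Proof.
apply: (freeprod_ext (f := fp_prod_fun f g \o fp_reindex (@rshift m n))
  (g := fp_reindex (@rshift m n) \o g)) => i x /=.
by rewrite !fp_lift_in (unsplitK (inr _ i)).
Qed.

Lemma fp_prod_fun_can (f f' : {multiplicative fpow G m -> fpow G m})
    (g g' : {multiplicative fpow G n -> fpow G n}) :
  cancel f f' -> cancel g g' -> cancel (fp_prod_fun f g) (fp_prod_fun f' g').
Proof.
move=> fK gK; apply: (freeprod_ext (f := fp_prod_fun f' g' \o fp_prod_fun f g)
  (g := idfun)) => i x /=.
rewrite fp_lift_in; case: split_ordP => j -> /=.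
  by rewrite fp_prod_funl fK fp_lift_in.
by rewrite fp_prod_funr gK fp_lift_in.
Qed.

Lemma fp_prod_fun_bij (f : aut (fpow G m)) (g : aut (fpow G n)) :
  bijective (fp_prod_fun f g).
Proof.
exists (fp_prod_fun (f^-1 : aut _) (g^-1 : aut _)); apply: fp_prod_fun_can => a;
by rewrite ?aut_VK ?aut_KV.
Qed.

Definition faut_prod (f : aut (fpow G m)) (g : aut (fpow G n)) :
    aut (fpow G (m + n)) := Aut (fp_prod_fun_bij f g).

(* The index map of the commutativity isomorphism, with indices counted from 0;
   [ord_swapE] below is the formula in terms of natural numbers. *)
Definition ord_swap (i : 'I_(m + n)) : 'I_(m + n) :=
  cast_ord (addnC n m)
    match split i with inl j => rshift n j | inr k => lshift m k end.

Lemma ord_swapE i : ord_swap i = (if i < m then i + n else i - m)%N :> nat.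
Proof.
by rewrite /ord_swap; case: split_ordP => j -> /=; rewrite ?addKn // addnC.
Qed.

Lemma ord_swap_inj : injective ord_swap.
Proof.
move=> i j /cast_ord_inj; case: split_ordP => i' ->; case: split_ordP => j' ->.
- by move/rshift_inj->.
- by move/eqP; rewrite eq_rlshift.
- by move/eqP; rewrite eq_lrshift.
- by move/lshift_inj->.
Qed.

End Blocks.

Definition fswap_fun (m n : nat) :
    {multiplicative fpow G (m + n) -> fpow G (m + n)} :=
  fp_reindex (@ord_swap m n).

Lemma fswap_fun_bij (m n : nat) : bijective (fswap_fun m n).
Proof.
have [t sK tK] := injF_bij (@ord_swap_inj m n).
exists (fp_reindex t) => a.
  apply: (freeprod_ext (f := fp_reindex t \o fswap_fun m n)
    (g := idfun)) => i x /=.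
  by rewrite !fp_lift_in sK.
apply: (freeprod_ext (f := fswap_fun m n \o fp_reindex t)
  (g := idfun)) => i x /=.
by rewrite !fp_lift_in tK.
Qed.

Definition faut_swap (m n : nat) : aut (fpow G (m + n)) :=
  Aut (fswap_fun_bij m n).

Lemma faut_swap_in (m n : nat) (i : 'I_(m + n)) (x : G) :
  faut_swap m n (fp_in G i x) = fp_in G (ord_swap i) x.
Proof. exact: fp_lift_in. Qed.

End FreePower.

Section Families.
Variable G : groupType.

Definition Aut_cat : permcat_data :=
  group_permcat (A := fun n => aut (pow G n)) (@aut_prod G) (@aut_swap G).

Definition Hol_cat : permcat_data :=
  group_permcat (A := fun n => hol (pow G n)) (@hol_prod G) (@hol_swap G).

Definition Aut_free_cat : permcat_data :=
  group_permcat (A := fun n => aut (fpow G n)) (@faut_prod G) (@faut_swap G).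

Definition Hol_to_Aut : functor_data Hol_cat Aut_cat :=
  group_functor _ _ _ _ (fun n => @hol_aut (pow G n)).

Definition Aut_to_Hol : functor_data Aut_cat Hol_cat :=
  group_functor _ _ _ _ (fun n => @hol_sect (pow G n)).

End Families.

(* Main.v *)
(* Once the equalities between m + n and n + m, m + (n + p) and (m + n) + p, ...
   are made explicit as casts, the axioms become identities between
   automorphisms of one group G^k or *_k G. An automorphism of G^(m+n) is
   determined by its values on concatenations, one of *_(m+n) G by its
   restrictions to the first m and the last n factors. Products and swaps are
   computed blockwise there, so each identity reduces to an equality of cast
   concatenations or of cast inclusions. The second component of Hol adds only
   that (f x g)^-1 acts blockwise. *)
Require Import Defs.
From HB Require Import structures.
From mathcomp Require Import all_boot.

Set Implicit Arguments.
Unset Strict Implicit.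
Unset Printing Implicit Defensive.

Local Open Scope group_scope.

(** * Transport between the groups [A n] along equalities of natural numbers *)

Section Cast.
Variable A : nat -> groupType.

Lemma gcast_id n (e : n = n) (x : A n) : gcast e x = x.
Proof. by rewrite (eq_irrelevance e erefl). Qed.

(** Equality on [nat] is decidable, so its proofs are unique. This closes every goal in which one
    element has been cast along two different chains of equalities. *)
Lemma gcast_irr m n (e e' : m = n) (x : A n) : gcast e x = gcast e' x.
Proof. by rewrite (eq_irrelevance e e'). Qed.

Lemma gcast_comp m n p (e : m = n) (e' : n = p) (x : A p) :
  gcast e (gcast e' x) = gcast (etrans e e') x.
Proof. by case: _ / e' x; case: _ / e. Qed.

Lemma gcastK m n (e : m = n) (x : A n) : gcast (esym e) (gcast e x) = x.
Proof. by case: _ / e x. Qed.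

Lemma gcastVK m n (e : m = n) (x : A m) : gcast e (gcast (esym e) x) = x.
Proof. by case: _ / e x. Qed.

Lemma gcast1 m n (e : m = n) : gcast e (1 : A n) = 1.
Proof. by case: _ / e. Qed.

Lemma gcastM m n (e : m = n) (x y : A n) :
  gcast e (x * y) = gcast e x * gcast e y.
Proof. by case: _ / e x y. Qed.

Lemma ghomP m n (f g : ghom A m n) : val f = val g -> f = g.
Proof. exact: val_inj. Qed.

(** A morphism forces its codomain to equal its domain, so an equality [e] of domains is all that
    must be supplied; those of codomains follow from [f] and [g]. *)
Lemma arr_group_eq {bx : forall m n, A m -> A n -> A (m + n)%N}
    {c : forall m n, A (m + n)%N} m n m' n'
    (f : ghom A m n) (g : ghom A m' n') (e : m = m') :
  val f = gcast e (val g) ->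
  @arr (group_permcat bx c) m n f = @arr (group_permcat bx c) m' n' g.
Proof.
case: _ / e g => g; rewrite gcast_id.
case: f g => [f fn] [g gn] /= fg; case: _ / fg.
move: (eqP fn) (eqP gn) => efn egn.
case: _ / efn fn => fn; case: _ / egn gn => gn.
by rewrite (bool_irrelevance fn gn).
Qed.

End Cast.

(** * Reduction of the permutative axioms to identities in the groups [A n] *)

Section GroupPermcat.
Variables (A : nat -> groupType) (bx : forall m n, A m -> A n -> A (m + n)%N).
Variable c : forall m n, A (m + n)%N.

(** Morphisms are stored in the group of their domain, which a change of codomain does not touch. *)
Lemma val_hom_castr (m n n' : nat) (e : n = n') (f : ghom A m n) :
  val (@hom_castr (group_permcat bx c) m n n' e f : ghom A m n') = val f.
Proof. by case: _ / e. Qed.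

Lemma gcast_bx m m' n n' (e1 : m = m') (e2 : n = n') e (x : A m') (y : A n') :
  bx (gcast e1 x) (gcast e2 y) = gcast (e : m + n = m' + n')%N (bx x y).
Proof. by case: _ / e1 e x; case: _ / e2 y => y e x; rewrite !gcast_id. Qed.

Lemma gcast_c m m' n n' (e : (m + n = m' + n')%N) :
  m = m' -> n = n' -> gcast e (c m' n') = c m n.
Proof. by move=> e1 e2; case: _ / e1 e; case: _ / e2 => e; rewrite gcast_id. Qed.

Hypothesis bx1 : forall m n, bx (1 : A m) (1 : A n) = 1.
Hypothesis bxM : forall m n (f' f : A m) (g' g : A n),
  bx (f' * f) (g' * g) = bx f' g' * bx f g.
Hypothesis bxA : forall m n p (f : A m) (g : A n) (h : A p),
  bx f (bx g h) = gcast (addnA m n p) (bx (bx f g) h).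
Hypothesis bx0 : forall m (f : A m), bx f (1 : A 0%N) = gcast (addn0 m) f.
Hypothesis bx0l : forall m (f : A m), bx (1 : A 0%N) f = gcast (add0n m) f.
Hypothesis c_nat : forall m n (f : A m) (g : A n),
  c m n * bx f g = gcast (addnC m n) (bx g f) * c m n.
Hypothesis cK : forall m n, gcast (addnC m n) (c n m) * c m n = 1.
Hypothesis c0 : forall m, c m 0 = 1.
Hypothesis c0l : forall m, c 0 m = 1.
Hypothesis c_hexagon : forall m n p (e : (m + n + p = p + m + n)%N),
  gcast e (bx (c p m) (1 : A n)) * c (m + n)%N p
  = gcast (esym (addnA m n p)) (bx (1 : A m) (c n p)).

Lemma group_permcat_permutative : is_permutative (group_permcat bx c).
Proof.
(* The two composites are the instances of [cK] at [m], [n] and at [n], [m]. *)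
have invC m n : @inverse_hom (group_permcat bx c) (m + n)%N (n + m)%N
    (gbraid c m n) (gbraid c n m).
  by split; apply: ghomP => /=; rewrite (gcast_irr _ (addnC _ _)) cK.
(* The proof of [boxA] is fixed here because the statement of [braid_hexagon] casts along it. *)
apply: (@IsPermutative (group_permcat bx c) _ _ _ _ _ _ _ addnA).
- by move=> m n f; apply: ghomP; rewrite /= gcast1 mul1g.
- by move=> m n f; apply: ghomP; rewrite /= mulg1 gcast_id.
- move=> m n p q h g f; apply: ghomP.
  by rewrite /= gcastM mulgA gcast_comp; congr (_ * _ * _); apply: gcast_irr.
- by move=> m n; apply: ghomP; rewrite /= bx1.
- move=> m m' m'' n n' n'' f' f g' g; apply: ghomP.
  by rewrite /= bxM; congr (_ * _); apply: gcast_bx.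
(* Composition produces [c m' n'] at the codomains of [f] and [g]; [gcast_c] brings it back to
   [c m n]. *)
- move=> m n m' n' f g; apply: ghomP; rewrite /= gcast_c.
  + rewrite [LHS]c_nat; congr (_ * _); apply: gcast_irr.
  + exact: (eqP (valP f)).
  + exact: (eqP (valP g)).
- by move=> m n; exists (gbraid c n m).
- by move=> *; apply: (arr_group_eq (e := addnA _ _ _)); apply: bxA.
- exact: addn0.
- exact: add0n.
- by move=> *; apply: (arr_group_eq (e := addn0 _)); apply: bx0.
- by move=> *; apply: (arr_group_eq (e := add0n _)); apply: bx0l.
- by move=> m; apply: (arr_group_eq (e := addn0 m)); rewrite /= c0 gcast1.
- by move=> m; apply: (arr_group_eq (e := add0n m)); rewrite /= c0l gcast1.
- exact: invC.
- move=> m n p; apply: (arr_group_eq (e := esym (addnA m n p))) => /=.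
  by rewrite val_hom_castr; apply: c_hexagon.
Qed.

End GroupPermcat.

(** * Permutative functors from compatible families of homomorphisms *)

Lemma group_functor_permutative (A B : nat -> groupType)
    (bA : forall m n, A m -> A n -> A (m + n)%N) (cA : forall m n, A (m + n)%N)
    (bB : forall m n, B m -> B n -> B (m + n)%N) (cB : forall m n, B (m + n)%N)
    (phi : forall n, A n -> B n) :
  (forall n, phi n 1 = 1) ->
  (forall n, {morph phi n : x y / x * y}) ->
  (forall m n x y, phi _ (bA m n x y) = bB m n (phi m x) (phi n y)) ->
  (forall m n, phi _ (cA m n) = cB m n) ->
  is_permutative_functor (group_functor bA cA bB cB phi).
Proof.
move=> phi1 phiM phib phic.
(* Composition is a product with one factor cast, so preserving products suffices once [phi]
   commutes with casts. *)
have phi_cast m n (e : m = n) x : phi m (gcast e x) = gcast e (phi n x).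
  by case: _ / e x.
split=> //.
- by move=> n; apply: ghomP; apply: phi1.
- move=> m n p g f; apply: ghomP; rewrite /= phiM phi_cast.
  by congr (_ * _); apply: gcast_irr.
- move=> m m' n n' f g; apply: (arr_group_eq (e := erefl)).
  by rewrite gcast_id /= phib.
- by move=> m n; apply: (arr_group_eq (e := erefl)); rewrite gcast_id /= phic.
Qed.

(** * Automorphisms of direct powers *)

Section DirectPower.
Variable G : groupType.

Notation P := (pow G).
Notation AP := (fun n => aut (pow G n) : groupType).
Notation HP := (fun n => hol (pow G n) : groupType).

Lemma pow_catP m n (Q : P (m + n)%N -> Prop) :
  (forall x y, Q (pow_cat x y)) -> forall z, Q z.
Proof. by move=> Qcat z; rewrite -(pow_catE z). Qed.

Lemma gcast_powE m n (e : m = n) (x : P n) i :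
  (gcast e x : P m) i = x (cast_ord e i).
Proof. by case: _ / e x => x; rewrite cast_ord_id. Qed.

Lemma gcast_autE m n (e : m = n) (f : AP n) (x : P m) :
  (gcast (A := AP) e f) x = gcast e (f (gcast (esym e) x)).
Proof. by case: _ / e f. Qed.

Lemma aut_prodE m n (f : aut (P m)) (g : aut (P n)) x y :
  aut_prod f g (pow_cat x y) = pow_cat (f x) (g y).
Proof. by rewrite /= /prod_fun pow_catl pow_catr. Qed.

Lemma aut_swapE m n (x : P m) (y : P n) :
  aut_swap G m n (pow_cat x y) = gcast (addnC m n) (pow_cat y x).
Proof.
by apply/ffunP => i; rewrite /= ffunE pow_catl pow_catr gcast_powE.
Qed.

Lemma pow_catA m n p (x : P m) (y : P n) (z : P p) :
  pow_cat x (pow_cat y z) = gcast (addnA m n p) (pow_cat (pow_cat x y) z).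
Proof.
apply/ffunP => i; rewrite gcast_powE !ffunE.
(* In each of the three blocks, the cast index is the same natural number bracketed the other
   way. *)
case: split_ordP => j ->; last first.
  rewrite ffunE; case: split_ordP => k ->.
    rewrite (_ : cast_ord _ _ = lshift p (rshift m k)); last exact: val_inj.
    by rewrite (unsplitK (inl _ _)) ffunE (unsplitK (inr _ _)).
  rewrite (_ : cast_ord _ _ = rshift (m + n) k); last first.
    by apply: val_inj; rewrite /= addnA.
  by rewrite (unsplitK (inr _ _)).
rewrite (_ : cast_ord _ _ = lshift p (lshift n j)); last exact: val_inj.
by rewrite (unsplitK (inl _ _)) ffunE (unsplitK (inl _ _)).
Qed.

Lemma pow_cat0 m (x : P m) (y : P 0) : pow_cat x y = gcast (addn0 m) x.
Proof.
apply/ffunP => i; rewrite gcast_powE ffunE; case: split_ordP => [j ->|[] //].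
by congr (x _); apply: val_inj.
Qed.

Lemma pow_cat0l m (x : P 0) (y : P m) : pow_cat x y = gcast (add0n m) y.
Proof.
apply/ffunP => i; rewrite gcast_powE ffunE; case: split_ordP => [[] //|j ->].
by congr (y _); apply: val_inj.
Qed.

Lemma pow_cat_castl m m' n (e : m = m') e' (x : P m') (y : P n) :
  pow_cat (gcast e x) y = gcast (e' : (m + n = m' + n)%N) (pow_cat x y).
Proof. by case: _ / e e' x => e' x; rewrite !gcast_id. Qed.

Lemma pow_cat_castr m n n' (e : n = n') e' (x : P m) (y : P n') :
  pow_cat x (gcast e y) = gcast (e' : (m + n = m + n')%N) (pow_cat x y).
Proof. by case: _ / e e' y => e' y; rewrite !gcast_id. Qed.

Lemma pow_cat1 m n : pow_cat (1 : P m) (1 : P n) = 1.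
Proof. by apply/ffunP => i; rewrite !ffunE; case: split => j; rewrite ffunE. Qed.

Lemma aut_prod1 m n : aut_prod (1 : AP m) (1 : AP n) = 1.
Proof. by apply: autP; apply: pow_catP => x y; rewrite aut_prodE. Qed.

Lemma aut_prodM m n (f' f : AP m) (g' g : AP n) :
  aut_prod (f' * f) (g' * g) = aut_prod f' g' * aut_prod f g.
Proof.
by apply: autP; apply: pow_catP => x y; rewrite aut_mulE !aut_prodE.
Qed.

(** Inverses of automorphisms are obtained by choice and do not compute, so both sides are compared
    after applying the injective map [aut_prod f g]. *)
Lemma aut_prodVE m n (f : aut (P m)) (g : aut (P n)) x y :
  (aut_prod f g)^-1 (pow_cat x y) = pow_cat (f^-1 x) (g^-1 y).
Proof.
by apply: (can_inj (aut_VK (aut_prod f g))); rewrite aut_KV aut_prodE !aut_KV.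
Qed.

Lemma aut_prodA m n p (f : AP m) (g : AP n) (h : AP p) :
  aut_prod f (aut_prod g h)
  = gcast (A := AP) (addnA m n p) (aut_prod (aut_prod f g) h).
Proof.
apply: autP; apply: pow_catP => x; apply: pow_catP => y z.
(* Only the argument on the right is rebracketed: its new cast cancels the one coming from
   [gcast_autE]. *)
rewrite gcast_autE {2}pow_catA gcast_comp gcast_id !aut_prodE.
exact: pow_catA.
Qed.

Lemma aut_prod0 m (f : AP m) :
  aut_prod f (1 : AP 0%N) = gcast (A := AP) (addn0 m) f.
Proof.
apply: autP; apply: pow_catP => x y.
by rewrite gcast_autE aut_prodE !pow_cat0 gcast_comp gcast_id.
Qed.

Lemma aut_prod0l m (f : AP m) :
  aut_prod (1 : AP 0%N) f = gcast (A := AP) (add0n m) f.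
Proof.
apply: autP; apply: pow_catP => x y.
by rewrite gcast_autE aut_prodE !pow_cat0l gcast_comp gcast_id.
Qed.

Lemma aut_swap_nat m n (f : AP m) (g : AP n) :
  aut_swap G m n * aut_prod f g
  = gcast (A := AP) (addnC m n) (aut_prod g f) * aut_swap G m n.
Proof.
apply: autP; apply: pow_catP => x y; rewrite !aut_mulE gcast_autE aut_prodE.
by rewrite !aut_swapE gcast_comp gcast_id aut_prodE.
Qed.

Lemma aut_swapK m n :
  gcast (A := AP) (addnC m n) (aut_swap G n m) * aut_swap G m n = 1.
Proof.
apply: autP; apply: pow_catP => x y; rewrite !aut_mulE gcast_autE !aut_swapE.
by rewrite gcast_comp gcast_id aut_swapE gcast_comp gcast_id.
Qed.

Lemma aut_swap0 m : aut_swap G m 0 = 1.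
Proof.
apply: autP; apply: pow_catP => x y.
(* Both sides have become casts of [x], the block over the empty index set having disappeared. *)
by rewrite aut_swapE pow_cat0 pow_cat0l gcast_comp; apply: gcast_irr.
Qed.

Lemma aut_swap0l m : aut_swap G 0 m = 1.
Proof.
apply: autP; apply: pow_catP => x y.
by rewrite aut_swapE pow_cat0 pow_cat0l gcast_comp; apply: gcast_irr.
Qed.

(** Up to casts, the left side sends $(x,y,z)$ to $(z,x,y)$ and then to $(x,z,y)$, which the right
    side reaches in one step. *)
Lemma aut_swap_hexagon m n p (e : (m + n + p = p + m + n)%N) :
  gcast (A := AP) e (aut_prod (aut_swap G p m) (1 : AP n))
    * aut_swap G (m + n) p
  = gcast (A := AP) (esym (addnA m n p)) (aut_prod 1 (aut_swap G n p)).
Proof.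
apply: autP; apply: pow_catP; apply: pow_catP => x y z.
rewrite aut_mulE !gcast_autE aut_swapE gcast_comp pow_catA gcast_comp gcast_id.
rewrite aut_prodE aut_swapE (pow_cat_castl _ (congr1 (addn^~ n) (addnC p m))).
(* The right side acts on the last two blocks together, so its argument has to be bracketed to the
   right. *)
have -> : pow_cat (pow_cat x y) z
    = gcast (esym (addnA m n p)) (pow_cat x (pow_cat y z)).
  by rewrite pow_catA gcast_comp gcast_id.
rewrite [gcast (esym (esym _)) _]gcast_comp gcast_id aut_prodE aut_swapE.
rewrite (pow_cat_castr _ (congr1 (addn m) (addnC n p))) pow_catA !gcast_comp.
exact: gcast_irr.
Qed.

Lemma Aut_cat_permutative : is_permutative (Aut_cat G).
Proof.
apply: (@group_permcat_permutative AP).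
- exact: aut_prod1.
- exact: aut_prodM.
- exact: aut_prodA.
- exact: aut_prod0.
- exact: aut_prod0l.
- exact: aut_swap_nat.
- exact: aut_swapK.
- exact: aut_swap0.
- exact: aut_swap0l.
- exact: aut_swap_hexagon.
Qed.

(** * Holomorphs of direct powers and the functors to and from automorphisms *)

Lemma gcast_holE m n (e : m = n) (f : aut (P n)) (x : P n) :
  gcast (A := HP) e (Hol f x) = Hol (gcast (A := AP) e f) (gcast e x).
Proof. by case: _ / e f x. Qed.

Lemma hol_mulE n (f g : AP n) (x y : P n) :
  (Hol f x : HP n) * Hol g y = Hol (f * g) (g^-1 x * y).
Proof. by []. Qed.

(** The braids have trivial second component; this rule and [hol_mulE1] simplify products with a
    braid on the left and on the right. *)
Lemma hol_mul1E n (f g : AP n) (y : P n) :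
  (Hol f 1 : HP n) * Hol g y = Hol (f * g) y.
Proof. by rewrite hol_mulE aut1g mul1g. Qed.

Lemma hol_mulE1 n (f g : AP n) (x : P n) :
  (Hol f x : HP n) * Hol g 1 = Hol (f * g) (g^-1 x).
Proof. by rewrite hol_mulE mulg1. Qed.

Lemma hol_prodE m n (f : aut (P m)) (g : aut (P n)) x y :
  hol_prod (Hol f x) (Hol g y) = Hol (aut_prod f g) (pow_cat x y).
Proof. by []. Qed.

Lemma Hol_cat_permutative : is_permutative (Hol_cat G).
Proof.
apply: (@group_permcat_permutative HP).
- by move=> m n; rewrite /hol_prod aut_prod1 pow_cat1.
- move=> m n [f' x'] [f x] [g' y'] [g y].
  rewrite !hol_mulE hol_prodE pow_catM -aut_prodVE.
  by congr Hol; apply: aut_prodM.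
- move=> m n p [f x] [g y] [h z].
  by rewrite !hol_prodE gcast_holE -aut_prodA -pow_catA.
- by move=> m [f x]; rewrite gcast_holE hol_prodE aut_prod0 pow_cat0.
- by move=> m [f x]; rewrite gcast_holE hol_prodE aut_prod0l pow_cat0l.
(* On the right the second component is $s_{m,n}^{-1}$ applied to the cast of [pow_cat y x]; by
   [aut_swapE] that cast is $s_{m,n}$ of [pow_cat x y], and the two maps cancel. *)
- move=> m n [f x] [g y]; rewrite !hol_prodE gcast_holE hol_mul1E hol_mulE1.
  by rewrite aut_swap_nat -aut_swapE aut_VK.
- by move=> m n; rewrite gcast_holE hol_mulE1 aut_swapK gcast1 aut1g.
- by move=> m; rewrite /hol_swap aut_swap0.
- by move=> m; rewrite /hol_swap aut_swap0l.
- move=> m n p e; rewrite !hol_prodE !gcast_holE hol_mulE1 aut_swap_hexagon.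
  by rewrite !pow_cat1 !gcast1 aut1g.
Qed.

Lemma Hol_to_Aut_permutative : is_permutative_functor (Hol_to_Aut G).
Proof. exact: (@group_functor_permutative HP AP). Qed.

(** The section is multiplicative because automorphisms fix the identity: $g^{-1}(1)\,1=1$. *)
Lemma Aut_to_Hol_permutative : is_permutative_functor (Aut_to_Hol G).
Proof.
apply: (@group_functor_permutative AP HP) => //.
- by move=> n f g; rewrite /hol_sect hol_mulE aut1g mulg1.
- by move=> m n f g; rewrite /hol_sect /hol_prod /= pow_cat1.
Qed.

End DirectPower.

(** * Automorphisms of free powers *)

Section FreePower.
Variable G : groupType.

Notation F := (fpow G).
Notation AF := (fun n => aut (fpow G n) : groupType).

(** The canonical inclusions of the first [m] and the last [n] free factors. *)
Notation inl_ m n :=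
  (fp_reindex G (@lshift m n) : {multiplicative F m -> F (m + n)%N}).
Notation inr_ m n :=
  (fp_reindex G (@rshift m n) : {multiplicative F n -> F (m + n)%N}).
Notation fcast := (gcast (A := F)).

Lemma fp_reindex_in (I J : finType) (s : I -> J) i x :
  fp_reindex G s (fp_in G i x) = fp_in G (s i) x.
Proof. exact: fp_lift_in. Qed.

Lemma fp_reindex_comp (I J K : finType) (s : J -> K) (t : I -> J) a :
  fp_reindex G s (fp_reindex G t a) = fp_reindex G (s \o t) a.
Proof.
apply: (freeprod_ext (f := fp_reindex G s \o fp_reindex G t)
  (g := fp_reindex G (s \o t))) => i x /=.
by rewrite !fp_reindex_in.
Qed.

Lemma eq_fp_reindex (I J : finType) (s t : I -> J) :
  s =1 t -> fp_reindex G s =1 fp_reindex G t.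
Proof. by move=> st; apply: freeprod_ext => i x; rewrite !fp_reindex_in st. Qed.

(** Casts thus become renamings of free factors, like the inclusions and swaps, and identities among
    all of these reduce to equalities of index maps. *)
Lemma gcast_fpowE m n (e : m = n) (a : F n) :
  gcast e a = fp_reindex G (cast_ord (esym e)) a.
Proof.
case: _ / e a => a; apply: (freeprod_ext (f := idfun)
  (g := fp_reindex G (cast_ord (esym erefl)))) => i x.
by rewrite fp_reindex_in cast_ord_id.
Qed.

Lemma gcast_fautE m n (e : m = n) (f : AF n) (a : F m) :
  (gcast (A := AF) e f) a = gcast e (f (gcast (esym e) a)).
Proof. by case: _ / e f. Qed.

Lemma faut_prodl m n (f : aut (F m)) (g : aut (F n)) a :
  faut_prod f g (inl_ m n a) = inl_ m n (f a).
Proof. exact: fp_prod_funl. Qed.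

Lemma faut_prodr m n (f : aut (F m)) (g : aut (F n)) a :
  faut_prod f g (inr_ m n a) = inr_ m n (g a).
Proof. exact: fp_prod_funr. Qed.

Lemma faut_ext m n (f g : aut (F (m + n))) :
  (forall a, f (inl_ m n a) = g (inl_ m n a)) ->
  (forall a, f (inr_ m n a) = g (inr_ m n a)) -> f = g.
Proof.
move=> fgl fgr; apply: autP; apply: freeprod_ext => i x.
by case: (split_ordP i) => j ->; rewrite -fp_reindex_in.
Qed.

Lemma faut_ext3 m n p (f g : aut (F (m + n + p))) :
  (forall a, f (inl_ _ p (inl_ m n a)) = g (inl_ _ p (inl_ m n a))) ->
  (forall a, f (inl_ _ p (inr_ m n a)) = g (inl_ _ p (inr_ m n a))) ->
  (forall a, f (inr_ _ p a) = g (inr_ _ p a)) -> f = g.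
Proof.
move=> fgl fgm fgr; apply: autP; apply: freeprod_ext => i x.
case: (split_ordP i) => j ->; last by rewrite -fp_reindex_in.
by case: (split_ordP j) => k ->; rewrite -!fp_reindex_in.
Qed.

Lemma inlA m n p a :
  inl_ m (n + p) a = fcast (addnA m n p) (inl_ _ p (inl_ m n a)).
Proof.
rewrite gcast_fpowE !fp_reindex_comp; apply: eq_fp_reindex => i.
exact: val_inj.
Qed.

Lemma inrlA m n p a :
  inr_ m (n + p) (inl_ n p a) = fcast (addnA m n p) (inl_ _ p (inr_ m n a)).
Proof.
rewrite gcast_fpowE !fp_reindex_comp; apply: eq_fp_reindex => i.
exact: val_inj.
Qed.

Lemma inrA m n p a :
  inr_ m (n + p) (inr_ n p a) = fcast (addnA m n p) (inr_ (m + n) p a).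
Proof.
rewrite gcast_fpowE !fp_reindex_comp; apply: eq_fp_reindex => i.
by apply: val_inj; rewrite /= addnA.
Qed.

Lemma inl0 m a : inl_ m 0 a = fcast (addn0 m) a.
Proof. by rewrite gcast_fpowE; apply: eq_fp_reindex => i; apply: val_inj. Qed.

Lemma inr0 m a : inr_ 0 m a = gcast (add0n m) a.
Proof. by rewrite gcast_fpowE; apply: eq_fp_reindex => i; apply: val_inj. Qed.

Lemma faut_swapl m n a :
  faut_swap G m n (inl_ m n a) = fcast (addnC m n) (inr_ n m a).
Proof.
rewrite gcast_fpowE [LHS]fp_reindex_comp fp_reindex_comp.
apply: eq_fp_reindex => i; apply: val_inj; rewrite [LHS]ord_swapE /=.
by rewrite ltn_ord addnC.
Qed.

Lemma faut_swapr m n a :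
  faut_swap G m n (inr_ m n a) = fcast (addnC m n) (inl_ n m a).
Proof.
rewrite gcast_fpowE [LHS]fp_reindex_comp fp_reindex_comp.
apply: eq_fp_reindex => i; apply: val_inj; rewrite [LHS]ord_swapE /=.
by rewrite ltnNge leq_addr addKn.
Qed.

Lemma faut_prod1 m n : faut_prod (1 : AF m) (1 : AF n) = 1.
Proof. by apply: faut_ext => a; rewrite ?faut_prodl ?faut_prodr. Qed.

Lemma faut_prodM m n (f' f : AF m) (g' g : AF n) :
  faut_prod (f' * f) (g' * g) = faut_prod f' g' * faut_prod f g.
Proof.
by apply: faut_ext => a; rewrite aut_mulE ?faut_prodl ?faut_prodr.
Qed.

Lemma faut_prodA m n p (f : AF m) (g : AF n) (h : AF p) :
  faut_prod f (faut_prod g h)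
  = gcast (A := AF) (addnA m n p) (faut_prod (faut_prod f g) h).
Proof.
(* The identity is moved to the group with index [m + n + p], where [faut_ext3] tests it on the
   three blocks. *)
apply: (can_inj (@gcastVK AF _ _ (addnA m n p))); rewrite [RHS]gcastK.
apply: faut_ext3 => a; rewrite gcast_fautE esymK.
- by rewrite -inlA !faut_prodl inlA gcastK.
- by rewrite -inrlA faut_prodr !faut_prodl faut_prodr inrlA gcastK.
- by rewrite -inrA !faut_prodr inrA gcastK.
Qed.

Lemma faut_prod0 m (f : AF m) :
  faut_prod f (1 : AF 0%N) = gcast (A := AF) (addn0 m) f.
Proof.
apply: autP; apply: freeprod_ext => i x.
case: (split_ordP i) => [j ->|[] //]; rewrite -fp_reindex_in gcast_fautE.
by rewrite faut_prodl !inl0 gcast_comp gcast_id.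
Qed.

Lemma faut_prod0l m (f : AF m) :
  faut_prod (1 : AF 0%N) f = gcast (A := AF) (add0n m) f.
Proof.
apply: autP; apply: freeprod_ext => i x.
case: (split_ordP i) => [[] //|j ->]; rewrite -fp_reindex_in gcast_fautE.
by rewrite faut_prodr !inr0 gcast_comp gcast_id.
Qed.

Lemma faut_swap_nat m n (f : AF m) (g : AF n) :
  faut_swap G m n * faut_prod f g
  = gcast (A := AF) (addnC m n) (faut_prod g f) * faut_swap G m n.
Proof.
apply: faut_ext => a; rewrite !aut_mulE gcast_fautE.
  by rewrite faut_prodl !faut_swapl gcast_comp gcast_id faut_prodr.
by rewrite faut_prodr !faut_swapr gcast_comp gcast_id faut_prodl.
Qed.

Lemma faut_swapK m n :
  gcast (A := AF) (addnC m n) (faut_swap G n m) * faut_swap G m n = 1.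
Proof.
apply: faut_ext => a; rewrite !aut_mulE gcast_fautE.
  by rewrite faut_swapl gcast_comp gcast_id faut_swapr gcast_comp gcast_id.
by rewrite faut_swapr gcast_comp gcast_id faut_swapl gcast_comp gcast_id.
Qed.

Lemma faut_swap0 m : faut_swap G m 0 = 1.
Proof.
apply: autP; apply: freeprod_ext => i x; rewrite faut_swap_in.
rewrite (_ : ord_swap i = i) //; apply: val_inj; rewrite [LHS]ord_swapE.
by case: (split_ordP i) => [j ->|[] //]; rewrite addn0.
Qed.

Lemma faut_swap0l m : faut_swap G 0 m = 1.
Proof.
apply: autP; apply: freeprod_ext => i x; rewrite faut_swap_in.
rewrite (_ : ord_swap i = i) //; apply: val_inj.
by rewrite [LHS]ord_swapE /= subn0.
Qed.

(** Both sides keep the first block in front, move the second to the end and the third to the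
    middle; after the casts cancel, only index maps remain to be compared. *)
Lemma faut_swap_hexagon m n p (e : (m + n + p = p + m + n)%N) :
  gcast (A := AF) e (faut_prod (faut_swap G p m) (1 : AF n))
    * faut_swap G (m + n) p
  = gcast (A := AF) (esym (addnA m n p)) (faut_prod 1 (faut_swap G n p)).
Proof.
apply: faut_ext3 => a; rewrite !aut_mulE !gcast_fautE esymK.
- rewrite -inlA faut_swapl inrlA gcast_comp gcast_comp gcast_id.
  rewrite !faut_prodl faut_swapr !gcast_fpowE !fp_reindex_comp.
  by apply: eq_fp_reindex => i; apply: val_inj.
- rewrite -inrlA faut_swapl inrA gcast_comp gcast_comp gcast_id.
  rewrite !faut_prodr faut_swapl !gcast_fpowE !fp_reindex_comp.
  apply: eq_fp_reindex => i; apply: val_inj.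
  (* The second block is shifted by [p + m] on the left and by [p], then [m], on the right. *)
  by rewrite /= [(p + m)%N]addnC addnA.
- rewrite -inrA faut_swapr inlA gcast_comp gcast_comp gcast_id.
  rewrite faut_prodl faut_prodr faut_swapl faut_swapr.
  rewrite !gcast_fpowE !fp_reindex_comp.
  by apply: eq_fp_reindex => i; apply: val_inj.
Qed.

Lemma Aut_free_cat_permutative : is_permutative (Aut_free_cat G).
Proof.
apply: (@group_permcat_permutative AF).
- exact: faut_prod1.
- exact: faut_prodM.
- exact: faut_prodA.
- exact: faut_prod0.
- exact: faut_prod0l.
- exact: faut_swap_nat.
- exact: faut_swapK.
- exact: faut_swap0.
- exact: faut_swap0l.
- exact: faut_swap_hexagon.
Qed.

End FreePower.

Theorem theorem5p3p1 (G : groupType) :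
  [/\ is_permutative (Aut_cat G),
      is_permutative (Hol_cat G),
      is_permutative (Aut_free_cat G),
      is_permutative_functor (Hol_to_Aut G)
    & is_permutative_functor (Aut_to_Hol G)].
Proof.
split.
- exact: Aut_cat_permutative.
- exact: Hol_cat_permutative.
- exact: Aut_free_cat_permutative.
- exact: Hol_to_Aut_permutative.
- exact: Aut_to_Hol_permutative.
Qed.
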